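(* Let $\pi$ be a measure preserving action of an amenable topological group $G$ on a probability space $(X,\mu)$. Then $\operatorname{E}_\mu^{(Oll)}(\pi)=\operatorname{E}_\mu^{(nv)}(\pi)$.
   Context: Topological groups are assumed Hausdorff. A topological group $G$ is amenable if every continuous action of $G$ on a non-empty compact Hausdorff space admits an invariant regular Borel probability measure; equivalently, $G$ admits a thin Følner net as defined below. An action $\pi$ of a topological group $G$ on a probability space $(X,\mu)$, written $\pi^g(x)=g.x$, is measure preserving if (1) $\pi^g$ is measurable for every $g\in G$; (2) $\mu(g.A)=\mu(A)$ for all $g\in G$ and measurable $A\subseteq X$; (3) for every measurable $A\subseteq X$ the map $g\mapsto\mu(A\triangle g.A)$ is continuous on $G$. For finite $E,F\subseteq G$ and a neighbourhood $U$ of the neutral element, let $\operatorname{match}(E,F,U)$ be the maximal cardinality of a subset $M\subseteq E$ for which there is an injection $\iota\colon M\to F$ with $x\,\iota(x)^{-1}\in U$ for all $x\in M$. A net $(F_i)_{i\in I}$ of non-empty finite subsets of $G$ is a thin Følner net if $\operatorname{match}(F_i,gF_i,U)/|F_i|\to1$ for every such $U$ and every $g\in G$. For a finite measurable partition $\alpha$ of $X$ put $H_\mu(\alpha)=-\sum_{A\in\alpha,\ \mu(A)>0}\mu(A)\log\mu(A)$, and for finite $F\subseteq G$ let $\alpha_F=\{\bigcap_{g\in F}g^{-1}.A(g)\mid A\in\alpha^F\}$. With suprema over all finite measurable partitions $\alpha$ of $X$, $$\operatorname{E}_\mu^{(Oll)}(\pi)=\sup_\alpha\lim_{i\in I}\frac{H_\mu(\alpha_{F_i})}{|F_i|},\qquad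 \operatorname{E}_\mu^{(nv)}(\pi)=\sup_\alpha\inf_{F}\frac{H_\mu(\alpha_F)}{|F|},$$ where $(F_i)_{i\in I}$ is a thin Følner net in $G$ (the limit exists and does not depend on the choice of the thin Følner net) and the infimum is over all non-empty finite $F\subseteq G$. *)

(* Defs.v *)
From HB Require Import structures.
From mathcomp Require Import all_boot all_order all_algebra finmap.
From mathcomp Require Import all_classical all_reals all_analysis.

Set Implicit Arguments.
Unset Strict Implicit.
Unset Printing Implicit Defensive.

Import Order.TTheory GRing.Theory Num.Theory.
Import numFieldNormedType.Exports.

Local Open Scope classical_set_scope.
Local Open Scope ring_scope.

(* The Hausdorff axiom is not part of this structure; statements assume
   [hausdorff_space G] separately. *)
HB.mixin Record isTopologicalGroup G of Group G & Topological G := {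
  mulg_continuous : continuous (fun p : G * G => (p.1 * p.2)%g) ;
  invg_continuous : continuous (fun x : G => (x^-1)%g)
}.

#[short(type="topologicalGroupType")]
HB.structure Definition TopologicalGroup :=
  {G of isTopologicalGroup G & Group G & Topological G}.

Definition is_group_action (G : groupType) (X : Type) (pi : G -> X -> X) :=
  (forall x, pi 1%g x = x) /\ (forall g h x, pi (g * h)%g x = pi g (pi h x)).

Section amenability.
Variable R : realType.

Local Notation borel K := (g_sigma_algebraType (@open K)).

Definition regular_borel (K : ptopologicalType) (nu : probability (borel K) R) :=
  forall A : set K, measurable (A : set (borel K)) ->
    nu A = ereal_inf [set nu V | V in [set V : set K | open V /\ A `<=` V]] /\
    nu A = ereal_sup [set nu C | C in [set C : set K | compact C /\ C `<=` A]].

(* Non-emptiness of [K] is built into [ptopologicalType]. *)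
Definition amenable (G : topologicalGroupType) :=
  forall (K : ptopologicalType) (pi : G -> K -> K),
    compact [set: K] -> hausdorff_space K ->
    is_group_action pi -> continuous (fun p : G * K => pi p.1 p.2) ->
    exists nu : probability (borel K) R,
      regular_borel nu /\
      forall (g : G) (A : set K), measurable (A : set (borel K)) ->
        nu (pi g @` A) = nu A.

End amenability.

Record directed_preorder (I : Type) (le : I -> I -> Prop) : Prop := {
  dp_refl : forall i, le i i ;
  dp_trans : forall i j k, le i j -> le j k -> le i k ;
  dp_inhabited : inhabited I ;
  dp_directed : forall i j, exists k, le i k /\ le j k
}.

(* Limits of a net [u : I -> T] are limits of [u @ tails le]. *)
Definition tails (I : Type) (le : I -> I -> Prop) : set_system I :=
  filter_from setT (fun i => [set j | le i j]).

Section thin_Folner.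
Variable G : topologicalGroupType.
Implicit Types (E F M : {fset G}) (U : set G) (g : G).

Definition matchable M F U : Prop :=
  exists iota : G -> G, {in M &, injective iota} /\
    forall x, x \in M -> iota x \in F /\ U (x * (iota x)^-1)%g.

Definition matching_number E F U : nat :=
  \max_(M <- fpowerset E | `[< matchable M F U >]) #|` M|.

Definition ltranslate g F : {fset G} := [fset (g * x)%g | x in F]%fset.

Definition thin_Folner_net (R : realType) (I : Type) (le : I -> I -> Prop)
    (F : I -> {fset G}) : Prop :=
  [/\ directed_preorder le,
      forall i, F i != fset0 &
      forall (U : set G) g, nbhs (1%g : G) U ->
        (((matching_number (F i) (ltranslate g (F i)) U)%:R / #|` F i|%:R : R)
           @[i --> tails le]) --> (1 : R)].

End thin_Folner.

Section entropy.
Variables (R : realType) (G : topologicalGroupType).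
Variables (d : measure_display) (X : measurableType d) (mu : probability X R).
Variable pi : G -> X -> X.

Record measure_preserving_action : Prop := {
  mpa_action : is_group_action pi ;
  mpa_measurable : forall g, measurable_fun [set: X] (pi g) ;
  mpa_preserving : forall g (A : set X), measurable A ->
    mu (pi g @` A) = mu A ;
  mpa_continuous : forall A : set X, measurable A ->
    continuous (fun g => mu (A `+` (pi g @` A)))
}.

Record finite_measurable_partition (alpha : set (set X)) : Prop := {
  fmp_finite : finite_set alpha ;
  fmp_measurable : forall A, alpha A -> measurable A ;
  fmp_disjoint : trivIset alpha id ;
  fmp_cover : \bigcup_(A in alpha) A = [set: X]
}.

Definition shannon_entropy (alpha : set (set X)) : R :=
  - \sum_(A \in [set A | alpha A /\ (0 < mu A)%E])
      fine (mu A) * ln (fine (mu A)).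

(* Only the values of [A] on [F] matter, so [A] ranges over the elements of
   [alpha ^ F] up to extension. *)
Definition refine_partition (alpha : set (set X)) (F : {fset G}) :
    set (set X) :=
  [set \bigcap_(g in [set` F]) (pi (g^-1)%g @` A g) |
     A in [set A : G -> set X | forall g, g \in F -> alpha (A g)]].

Definition mean_entropy (alpha : set (set X)) (F : {fset G}) : R :=
  shannon_entropy (refine_partition alpha F) / #|` F|%:R.

(* [F] is meant to be a thin Folner net in [G] indexed by [(I, le)]. *)
Definition Ollagnier_entropy (I : Type) (le : I -> I -> Prop)
    (F : I -> {fset G}) : \bar R :=
  ereal_sup [set (lim (mean_entropy alpha (F i) @[i --> tails le]))%:E |
               alpha in finite_measurable_partition].

Definition naive_entropy : \bar R :=
  ereal_sup [set ereal_inf [set (mean_entropy alpha F)%:E |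
                              F in [set F : {fset G} | F != fset0]] |
               alpha in finite_measurable_partition].

End entropy.

(* Main.v *)
(* Fix a partition alpha and put h(F) = H(alpha_F). This is a monotone,
   submodular function of the finite set F, invariant under right translations,
   and h({u, 1}) tends to h({1}) as u tends to 1. These properties alone force
   h(F_i) / |F_i| to converge to inf_E h(E) / |E|, so the two suprema agree term
   by term.

   Let E be finite. For each e in E take a maximal matching iota_e : M_e -> e F_i
   with M_e contained in F_i, and let K_g (g in F_i) be the set of x in F_i with
   iota_e(x) = e g for some e in E. Each point of K_g is U-close to a point of E g,
   hence h(K_g) is at most h(E) up to |K_g| eps. If U is so small that it
   separates the points of E (this uses that G is Hausdorff), then x lies in as
   many sets K_g as there are e with x in M_e, that is, in |E| of them for most x.
   Shearer's inequality then bounds |E| h(F_i) by the sum of the h(K_g), up to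
   a defect which vanishes in the limit. *)
Require Import Defs.
From HB Require Import structures.
From mathcomp Require Import all_boot all_order all_algebra finmap.
From mathcomp Require Import all_classical all_reals all_analysis.
From mathcomp Require Import ring lra.
Set Implicit Arguments.
Unset Strict Implicit.
Unset Printing Implicit Defensive.
Import Order.TTheory GRing.Theory Num.Theory.
Import numFieldNormedType.Exports.
Local Open Scope classical_set_scope.
Local Open Scope ring_scope.

(** * Entropy of weights on finite types and its submodularity *)

Section finite_entropy.
Variable R : realType.

Definition nxlnx (x : R) : R := - (x * ln x).

Lemma nxlnx0 : nxlnx 0 = 0. Proof. by rewrite /nxlnx mul0r oppr0. Qed.

Lemma ln_le_subr1 (x : R) : 0 < x -> ln x <= x - 1.
Proof. by move=> x0; rewrite -{1}[x](subrKC 1) le_ln1Dx// ltrBrDr addNr. Qed.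

(* [ln (1 / x) = 2 ln (1 / sqrt x) <= 2 / sqrt x] *)
Lemma nxlnx_le_sqrt (x : R) : 0 <= x -> nxlnx x <= 2 * Num.sqrt x.
Proof.
rewrite le_eqVlt => /predU1P[<-|x0]; first by rewrite nxlnx0 mulr_ge0.
rewrite /nxlnx -{1 2}(sqr_sqrtr (ltW x0)).
have : 0 < Num.sqrt x by rewrite sqrtr_gt0.
move: (Num.sqrt x) => s s0.
have := ln_le_subr1 (eq_ind_r is_true s0 (invr_gt0 s)).
rewrite lnV ?posrE// -(ler_pM2l s0) mulrBr divff ?gt_eqF// mulr1 => slns.
rewrite lnXn//.
have -> : - (s ^+ 2 * (ln s *+ 2)) = 2 * s * (s * - ln s) by ring.
by rewrite -[leRHS]mulr1 ler_pM2l ?mulr_gt0//; lra.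
Qed.

Lemma nxlnx_ge0 (x : R) : 0 <= x <= 1 -> 0 <= nxlnx x.
Proof.
by case/andP=> x0 x1; rewrite /nxlnx -mulrN mulr_ge0// oppr_ge0 ln_le0.
Qed.

(** Only x = 0 is delicate: [ln] is 0 on nonpositive reals, so [nxlnx] vanishes to the left, and to
    the right it is squeezed between 0 and [2 * Num.sqrt y]. *)
Lemma continuous_nxlnx (x : R) : 0 <= x -> {for x, continuous nxlnx}.
Proof.
rewrite le_eqVlt => /predU1P[<-|x0]; last first.
  apply: cvgN; apply: cvgM; first exact: cvg_id.
  exact: continuous_ln.
suff : nxlnx y @[y --> (0 : R)] --> (0 : R) by rewrite -{2}nxlnx0.
apply: norm_cvg0.
  apply: (@squeeze_cvgr _ _ _ _ (cst 0) (fun y => 2 * Num.sqrt `|y|)).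
  + near=> y; rewrite normr_ge0/=; have [y0|y0] := leP y 0.
      by rewrite /nxlnx ln0// mulr0 oppr0 normr0 mulr_ge0.
    have y1 : y <= 1 by apply/ltW; near: y; exact: lt_nbhsl.
    by rewrite (gtr0_norm y0) ger0_norm ?nxlnx_le_sqrt ?nxlnx_ge0 ?(ltW y0).
  + exact: cvg_cst.
  + rewrite -[X in _ --> X](mulr0 2) -[X in 2 * X]sqrtr0.
    rewrite -[X in Num.sqrt X](@normr0 R R); apply: cvgMr.
    apply: (@continuous_comp _ _ _ (fun y : R => `|y|) Num.sqrt); last first.
      exact: sqrt_continuous.
    exact: norm_continuous.
Unshelve. all: by end_near. Qed.

Definition fin_entropy (V : finType) (p : V -> R) : R := \sum_v nxlnx (p v).

Definition marginal (V U : finType) (p : V -> R) (k : V -> U) (u : U) : R :=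
  \sum_(v | k v == u) p v.

Section marginal.
Context (V U : finType) (p : V -> R) (k : V -> U).
Hypothesis p_ge0 : forall v, 0 <= p v.

Lemma marginal_ge0 u : 0 <= marginal p k u.
Proof. exact: sumr_ge0. Qed.

Lemma le_marginal v : p v <= marginal p k (k v).
Proof. by rewrite /marginal (bigD1 v)//= lerDl sumr_ge0. Qed.

Lemma sum_marginal (f : U -> R) :
  \sum_u marginal p k u * f u = \sum_v p v * f (k v).
Proof.
rewrite (partition_big k predT)//=; apply: eq_bigr => u _.
by rewrite mulr_suml; apply: eq_bigr => v /eqP ->.
Qed.

(** This writes the entropies of all marginals as sums over the same [V], so that they can be
    compared termwise. *)
Lemma fin_entropy_marginal :
  fin_entropy (marginal p k) = \sum_v - (p v * ln (marginal p k (k v))).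
Proof.
by rewrite sumrN -(sum_marginal (fun u => ln (marginal p k u))) -sumrN.
Qed.

Lemma le_fin_entropy_marginal : fin_entropy (marginal p k) <= fin_entropy p.
Proof.
rewrite fin_entropy_marginal; apply: ler_sum => v _; rewrite lerN2.
have := p_ge0 v; rewrite le_eqVlt => /predU1P[<-|pv]; first by rewrite !mul0r.
by rewrite ler_pM2l// ler_ln ?posrE ?le_marginal// (lt_le_trans pv)// le_marginal.
Qed.

Lemma fin_entropy_inj : injective k ->
  fin_entropy (marginal p k) = fin_entropy p.
Proof.
move=> k_inj; rewrite fin_entropy_marginal; apply: eq_bigr => v _.
by rewrite /marginal (big_pred1 v)// => w; rewrite /= (inj_eq k_inj).
Qed.

End marginal.

(** The inequality [ln q <= q - 1] at q = c b / (e p), multiplied by p. *)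
Lemma log_sum_pointwise (p b c e : R) : 0 <= p -> p <= b -> p <= c -> p <= e ->
  p - c * (b / e) <= p * ln p + p * ln e - p * ln c - p * ln b.
Proof.
rewrite le_eqVlt => /predU1P[<-|p0] pb pc pe.
  by rewrite !mul0r !subr0 addr0 sub0r oppr_le0 mulr_ge0// divr_ge0.
have b0 := lt_le_trans p0 pb; have c0 := lt_le_trans p0 pc.
have e0 := lt_le_trans p0 pe.
have q0 : 0 < c * (b / e) / p by rewrite divr_gt0// mulr_gt0// divr_gt0.
have := ln_le_subr1 q0.
rewrite !lnM ?lnV ?posrE ?invr_gt0 ?mulr_gt0 ?divr_gt0 ?invr_gt0//.
rewrite -(ler_pM2l p0) [X in _ <= X -> _]mulrBr mulrCA divff ?gt_eqF// !mulr1.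
lra.
Qed.

(* This is [H(s | t) <= H(s | k t)] for the random variable [(s, t)] of law [p]. *)
Lemma fin_entropy_submod (S T U : finType) (p : S * T -> R) (k : T -> U) :
  (forall z, 0 <= p z) ->
  fin_entropy p + fin_entropy (marginal p (k \o snd)) <=
  fin_entropy (marginal p (fun z => (z.1, k z.2))) + fin_entropy (marginal p snd).
Proof.
move=> p0; rewrite !fin_entropy_marginal /fin_entropy /nxlnx -!big_split/=.
set b := marginal p snd; set c := marginal p (fun z => (z.1, k z.2)).
set e := marginal p (k \o snd).
(* The weight c b / e makes s and t independent given [k t]. Summing over s first turns [c] into
   [e], which cancels. *)
have cbe : \sum_z c (z.1, k z.2) * (b z.2 / e (k z.2)) <= \sum_z p z.
  rewrite -(pair_bigA _ (fun s t => c (s, k t) * (b t / e (k t))))/=.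
  rewrite exchange_big/=.
  have -> : \sum_z p z = \sum_t b t.
    under [RHS]eq_bigr do rewrite -[b _]mulr1.
    by rewrite (sum_marginal _ _ (fun=> 1)); apply: eq_bigr => ? _; rewrite mulr1.
  apply: ler_sum => t _; rewrite -mulr_suml.
  have -> : \sum_s c (s, k t) = e (k t).
    rewrite /e /marginal (partition_big fst predT)//=; apply: eq_bigr => s _.
    by apply: eq_bigl => -[s' t'] /=; rewrite xpair_eqE andbC.
  (* Where [e] vanishes the quotient is 0 by convention, so the masses are only compared by an
     inequality. *)
  have [->|e0] := eqVneq (e (k t)) 0; last by rewrite mulrCA divff// mulr1.
  by rewrite mul0r marginal_ge0.
rewrite -subr_ge0 -sumrB.
have := cbe; rewrite -subr_ge0 -sumrB => /le_trans; apply.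
apply: ler_sum => z _.
have := @log_sum_pointwise (p z) (b z.2) (c (z.1, k z.2)) (e (k z.2)) (p0 z).
rewrite (le_marginal _ p0) (le_marginal (fun z => (z.1, k z.2)) p0 z).
rewrite (le_marginal (k \o snd) p0 z) => /(_ isT isT isT).
lra.
Qed.

End finite_entropy.

(** * Submodular set functions and Shearer's inequality *)

Section submodular_set_function.
Context (R : realType) (T : choiceType) (h : {fset T} -> R).
Implicit Types (x y : T) (A B K : {fset T}).

Record submodular_rank : Prop := {
  rank0 : h fset0 = 0 ;
  rank_mono : forall A B, (A `<=` B)%fset -> h A <= h B ;
  rank_submod : forall x A B, (A `<=` B)%fset ->
    h (x |` B)%fset - h B <= h (x |` A)%fset - h A
}.

Hypothesis h_rank : submodular_rank.

Lemma rank_ge0 A : 0 <= h A.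
Proof. by rewrite -(rank0 h_rank) rank_mono. Qed.

(* When [x] is added to [A], the gain [d] of [h A] satisfies [0 <= d <= D], and by
   submodularity each [K j] containing [x] gains at least [d]. *)
Lemma weighted_shearer (J : Type) (r : seq J) (K : J -> {fset T}) (m : nat)
    (D : R) A :
  (forall x, x \in A -> h [fset x]%fset <= D) ->
  (forall x, x \in A -> (\sum_(j <- r) (x \in K j) <= m)%N) ->
  m%:R * h A <= \sum_(j <- r) h (K j `&` A)%fset +
                \sum_(x <- A) (m%:R - (\sum_(j <- r) (x \in K j))%N%:R) * D.
Proof.
elim/fset1U_rect: A => [_ _|x A xA IH hD hm].
  rewrite (rank0 h_rank) mulr0 big_seq_fset0 addr0.
  by apply: sumr_ge0 => j _; exact: rank_ge0.
have inU y : y \in A -> y \in (x |` A)%fset by move=> yA; rewrite !inE yA orbT.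
have {}IH := IH (fun y yA => hD y (inU y yA)) (fun y yA => hm y (inU y yA)).
have {}hD := hD x (fset1U1 x A); have {}hm := hm x (fset1U1 x A).
rewrite big_fsetU1//=.
set c := (\sum_(j <- r) _)%N in hm *.
set d := h (x |` A)%fset - h A.
have d0 : 0 <= d by rewrite subr_ge0 (rank_mono h_rank)// fsubsetUr.
have dD : d <= D.
  have := rank_submod h_rank x (fsub0set A).
  by rewrite fsetU0 (rank0 h_rank) subr0 => /le_trans; apply.
have step : c%:R * d <=
    \sum_(j <- r) (h (K j `&` (x |` A))%fset - h (K j `&` A)%fset).
  rewrite /c natr_sum mulr_suml; apply: ler_sum => j _.
  rewrite fsetIUr; have [xK|xK] := boolP (x \in K j).
    rewrite mul1r (fsetIidPr _) ?fsub1set//; apply: (rank_submod h_rank).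
    exact: fsubsetIr.
  by rewrite mul0r subr_ge0 (rank_mono h_rank)// fsubsetUr.
rewrite sumrB in step.
(* The sets containing [x] pay for [c] copies of the gain; the missing [m - c] copies are charged at
   the price [D]. *)
have cm : (m%:R - c%:R) * d <= (m%:R - c%:R) * D.
  by rewrite ler_wpM2l// subr_ge0 ler_nat.
have -> : h (x |` A)%fset = h A + d by rewrite /d subrKC.
move: (\sum_(j <- r) _) (\sum_(j <- r) _) (\sum_(j <- A) _) IH step => s1 s2 s3.
lra.
Qed.

(** The points of [K] are added one at a time; by submodularity each gains at most what it gains
    over its partner [y] alone. *)
Lemma rank_union_le (e : R) K A :
  (forall x, x \in K ->
     exists2 y, y \in A & h [fset x; y]%fset - h [fset y]%fset <= e) ->
  h (K `|` A)%fset <= h A + #|` K|%:R * e.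
Proof.
elim/fset1U_rect: K => [_|x K xK IH hK].
  by rewrite fset0U cardfs0 mul0r addr0.
have inU y : y \in K -> y \in (x |` K)%fset by move=> yK; rewrite !inE yK orbT.
have {}IH := IH (fun y yK => hK y (inU y yK)).
have [y yA xy] := hK x (fset1U1 x K).
rewrite cardfsU1 xK natrD -fsetUA.
have : ([fset y] `<=` K `|` A)%fset by rewrite fsub1set inE yA orbT.
by move=> /(rank_submod h_rank x); rewrite mulrDl mul1r; lra.
Qed.

End submodular_set_function.

(** * Maximal matchings and separation of finite sets *)

Section matchings.
Context (G : topologicalGroupType).
Implicit Types (A B E F K M : {fset G}) (U : set G) (g : G).

Lemma matching_numberP E F U : exists M, [/\ (M `<=` E)%fset,
  matchable M F U & #|` M| = matching_number E F U].
Proof.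
rewrite /matching_number.
have : exists2 M, M \in fpowerset E & matchable M F U.
  exists fset0; first by rewrite fpowersetE fsub0set.
  by exists id; split=> // x.
pose P n := n = 0%N \/
  exists M, [/\ (M `<=` E)%fset, matchable M F U & #|` M| = n].
move=> [M0 M0E M0F].
have : P (\max_(M <- fpowerset E | `[< matchable M F U >]) #|` M|).
  rewrite big_seq_cond; elim/big_ind : _ => [|m n Pm Pn|M]; first by left.
    by rewrite /maxn; case: ifP.
  by case/andP => /[!fpowersetE] ME /asboolP MF; right; exists M.
(* The value 0 may be the default of the maximum and carry no witness; then [M0] itself has
   cardinality 0. *)
case=> // max0; exists M0; split; rewrite -?fpowersetE//; apply/eqP.
rewrite max0 -leqn0 -[leqRHS]max0.
by apply: (@leq_bigmax_seq _ _ _ (fun M => #|` M|)) => //; apply/asboolP.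
Qed.

(** For e != e', the complement of e e'^-1 is an open neighbourhood of 1, and (u, v) -> u^-1 v is
    continuous at (1, 1). The resulting neighbourhoods are intersected over the finitely many
    pairs. *)
Lemma separating_nbhs E : hausdorff_space G ->
  exists2 U : set G, nbhs (1%g : G) U &
    forall e e' u v, e \in E -> e' \in E -> U u -> U v ->
      (u^-1 * v = e * e'^-1)%g -> e = e'.
Proof.
move=> hG.
have sep1 e e' : exists2 U : set G, nbhs (1%g : G) U &
    forall u v, U u -> U v -> (u^-1 * v = e * e'^-1)%g -> e = e'.
  have [->|ne] := eqVneq e e'; first by exists setT; [exact: filterT|].
  have c1 : (e * e'^-1 != 1)%g by rewrite divg_eq1.
  have : nbhs (1%g * 1%g : G)%g (~` [set (e * e'^-1)%g]).
    rewrite mulg1; apply: open_nbhs_nbhs; split; last first.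
      by move=> /= h; rewrite -h eqxx in c1.
    exact/closed_openC/accessible_closed_set1/hausdorff_accessible.
  move=> /(@mulg_continuous G (1%g, 1%g)) [[/= P Q] [P1 Q1] PQ].
  exists ((fun x : G => x^-1%g) @^-1` P `&` Q).
    by apply: filterI => //; apply: invg_continuous; rewrite invg1.
  by move=> u v [Pu _] [_ Qv] uv; have := PQ (u^-1%g, v) (conj Pu Qv).
pose W e e' := s2val (cid2 (sep1 e e')).
exists (\bigcap_(e in [set` E]) \bigcap_(e' in [set` E]) W e e').
  apply: filter_bigI => e _; apply: filter_bigI => e' _.
  exact: s2valP (cid2 (sep1 e e')).
move=> e e' u v eE e'E Uu Uv; apply: (s2valP' (cid2 (sep1 e e'))).
  exact: Uu. exact: Uv.
Qed.

End matchings.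

Lemma sum_mem_subset (T : choiceType) (A B : {fset T}) : (B `<=` A)%fset ->
  (\sum_(x <- A) (x \in B))%N = #|` B|.
Proof.
move=> BA; rewrite -big_mkcond sum1_count -size_filter; apply: perm_size.
apply: uniq_perm; rewrite ?filter_uniq ?fset_uniq// => x.
by rewrite mem_filter andb_idr// => /(fsubsetP BA).
Qed.

Lemma sum_nat_has (T : eqType) (s : seq T) (P : pred T) : uniq s ->
  {in s &, forall x y, P x -> P y -> x = y} ->
  (\sum_(x <- s) P x)%N = has P s.
Proof.
move=> s_uniq P1; rewrite -big_mkcond sum1_count has_count.
have [->//|] := posnP (count P s); rewrite -has_count => /hasP[x xs Px].
rewrite (@eq_in_count _ _ (pred1 x)) ?count_uniq_mem ?xs// => y ys /=.
by apply/idP/eqP => [/P1|->//]; apply.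
Qed.

Lemma tails_proper (I : Type) (le : I -> I -> Prop) :
  directed_preorder le -> ProperFilter (tails le).
Proof.
case=> le_refl le_tr [i0] le_dir; apply: filter_from_proper.
  apply: filter_from_filter; first by exists i0.
  move=> i j _ _; have [k [ik jk]] := le_dir i j; exists k => // l kl.
  by split; [exact: le_tr kl|exact: le_tr kl].
by move=> i _; exists i; exact: le_refl.
Qed.

(** * Averages of a submodular function along a thin Følner net *)

Section thin_Folner_limit.
Context (R : realType) (G : topologicalGroupType).
Implicit Types (A B E F K M : {fset G}) (U : set G) (g : G).

Variable h : {fset G} -> R.
Hypothesis h_rank : submodular_rank h.
Hypothesis h_mulr : forall g A, h [fset (x * g)%g | x in A]%fset = h A.

Lemma rank1 g : h [fset g]%fset = h [fset 1%g]%fset.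
Proof. by rewrite -[RHS](h_mulr g) imfset_fset1 mul1g. Qed.

Lemma rank2 x y : h [fset x; y]%fset = h [fset (x * y^-1)%g; 1%g]%fset.
Proof. by rewrite -[RHS](h_mulr y) imfset_fset2 mul1g mulgVK. Qed.

(** Shearer's inequality for the sets [K g], with multiplicity [#|E|] and price [h {1}]; the last
    sum is the matching defect. *)
Lemma rank_mean_bound (U : set G) E F (e : R) :
  (forall a b u v, a \in E -> b \in E -> U u -> U v ->
     (u^-1 * v = a * b^-1)%g -> a = b) ->
  0 <= e ->
  (forall u, U u -> h [fset u; 1%g]%fset - h [fset 1%g]%fset <= e) ->
  #|` E|%:R * h F <= #|` F|%:R * h E + (#|` F| * #|` E|)%:R * e +
    \sum_(a <- E) (#|` F|%:R - (matching_number F (ltranslate a F) U)%:R)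
      * h [fset 1%g]%fset.
Proof.
move=> Usep e0 Ue.
have [M HM] := choice (fun a => matching_numberP F (ltranslate a F) U).
have [iota Hi] := choice (fun a => let: And3 _ m _ := HM a in m).
pose hit g x a := (x \in M a) && (iota a x == (a * g)%g).
pose K g := [fset x in F | has (hit g x) E]%fset.
have KF g : (K g `<=` F)%fset by apply/fsubsetP => x; rewrite !inE => /andP[].
have MF a : (M a `<=` F)%fset by case: (HM a).
have hitU g x a : hit g x a -> U (x * (a * g)^-1)%g.
  by case/andP => /(Hi a).2[_ Ux] /eqP <-.
(* Both sides count the pairs (g, a) with [hit g x a]: separation allows one a for each g, and
   [iota a x] determines g from a. *)
have cK x : x \in F -> (\sum_(g <- F) (x \in K g) = \sum_(a <- E) (x \in M a))%N.
  move=> xF; transitivity (\sum_(g <- F) \sum_(a <- E) hit g x a)%N.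
    apply: eq_bigr => g _.
    rewrite !inE xF/= sum_nat_has ?fset_uniq// => a b aE bE.
    move=> /hitU Ua /hitU Ub; apply: (Usep _ _ _ _ aE bE Ua Ub).
    by rewrite !invgM !invgK -!mulgA mulKg mulgA mulgA mulgK.
  rewrite exchange_big/=; apply: eq_bigr => a _; rewrite sum_nat_has ?fset_uniq//.
    congr nat_of_bool; apply/hasP/idP => [[g _ /andP[]//]|xM].
    have [+ _] := (Hi a).2 x xM; case/imfsetP => g /= gF ag.
    by exists g => //; rewrite /hit xM ag eqxx.
  by move=> g g' _ _ /andP[_ /eqP ag] /andP[_]; rewrite ag => /eqP/mulgI.
have sumK : (\sum_(g <- F) #|` K g| <= #|` F| * #|` E|)%N.
  under eq_bigr do rewrite -(sum_mem_subset (KF _)).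
  rewrite exchange_big/= big_seq -[leqRHS]muln1 -mulnA.
  rewrite -sum1_size big_distrl/= [leqRHS]big_seq; apply: leq_sum => x xF.
  rewrite cK// mul1n muln1 -sum1_size; apply: leq_sum => a _; exact: leq_b1.
(* Right invariance replaces [E] by E g, and moves a pair {x, a g} to {x (a g)^-1, 1}, whose first
   point lies in [U]. *)
have hK g : h (K g `&` F)%fset <= h E + #|` K g|%:R * e.
  rewrite -[h E](h_mulr g).
  have := @rank_union_le _ _ _ h_rank e (K g) [fset (x * g)%g | x in E]%fset.
  have /(rank_mono h_rank) :
      (K g `&` F `<=` K g `|` [fset (x * g)%g | x in E])%fset.
    exact: fsubset_trans (fsubsetIl _ _) (fsubsetUl _ _).
  move=> /le_trans + H; apply; apply: H => x.
  rewrite !inE => /andP[_ /hasP[a aE ha]]; exists (a * g)%g.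
    by apply/imfsetP; exists a.
  by rewrite rank2 [h [fset _]%fset]rank1; apply: Ue; exact: hitU.
have h1 x : x \in F -> h [fset x]%fset <= h [fset 1%g]%fset by rewrite rank1.
have cE x : x \in F -> (\sum_(g <- F) (x \in K g) <= #|` E|)%N.
  by move=> xF; rewrite cK// -sum1_size; apply: leq_sum => a _; exact: leq_b1.
apply: (le_trans (weighted_shearer h_rank h1 cE)); apply: lerD.
  apply: (le_trans (ler_sum _ (fun g _ => hK g))); rewrite big_split/=.
  rewrite -mulr_suml -natr_sum big_const_seq count_predT iter_addr_0.
  rewrite -[h E *+ _]mulr_natl.
  by rewrite lerD2l ler_wpM2r// ler_nat.
(* By [cK], the total defect counted over the points of [F] equals the one counted over the
   matchings [M a]. *)
rewrite -!mulr_suml ler_wpM2r ?(rank_ge0 h_rank)// le_eqVlt.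
apply/orP; left; apply/eqP.
rewrite !sumrB -!natr_sum; congr (_ - _).
  by rewrite !big_const_seq !count_predT !iter_addn_0 mulnC.
congr _%:R.
rewrite (eq_big_seq _ cK).
rewrite exchange_big/=; apply: eq_bigr => a _.
by rewrite sum_mem_subset//; case: (HM a).
Qed.

Hypothesis h_small : forall e : R, 0 < e -> exists2 U : set G, nbhs (1%g : G) U &
  forall u, U u -> h [fset u; 1%g]%fset - h [fset 1%g]%fset <= e.

Lemma rank_mean_lbound :
  lbound [set h E / #|` E|%:R | E in [set E | E != fset0]] 0.
Proof. by move=> _ [E _ <-]; rewrite divr_ge0// (rank_ge0 h_rank). Qed.

(** The infimum bounds every average from below; for the upper bound, [rank_mean_bound] is applied
    to an almost optimal [E] and divided by [#|E| #|F i|]. *)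
Lemma thin_Folner_rank_cvg (I : Type) (le : I -> I -> Prop) (F : I -> {fset G}) :
  hausdorff_space G -> thin_Folner_net R le F ->
  h (F i) / #|` F i|%:R @[i --> tails le] -->
    inf [set h E / #|` E|%:R | E in [set E | E != fset0]].
Proof.
move=> hG [/tails_proper PF F0 hF].
set S := [set _ | _ in _]; have S_inf : has_inf S.
  split; last by exists 0; exact: rank_mean_lbound.
  exists (h [fset 1%g]%fset / #|` [fset 1%g : G]%fset|%:R), [fset 1%g]%fset => //=.
  by rewrite -cardfs_eq0 cardfs1.
apply/cvgrPdist_le => /= e e0.
(* The error [e] is split into e/2 for the choice of [E], e/4 for moving points within [U], and e/4
   for the matching defect. *)
have e4 : 0 < e / 4 by rewrite divr_gt0.
have [_ [E /= E0 <-] hE] := inf_adherent (divr_gt0 e0 (ltr0n R 2)) S_inf.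
have [U U1 Usmall] := h_small e4.
have [V V1 Vsep] := separating_nbhs E hG.
have m0 : (0 : R) < #|` E|%:R by rewrite ltr0n cardfs_gt0.
pose r a i : R :=
  (matching_number (F i) (ltranslate a (F i)) (U `&` V))%:R / #|` F i|%:R.
have r1 a : r a i @[i --> tails le] --> (1 : R) by apply: hF; exact: filterI.
pose c := h [fset 1%g]%fset / #|` E|%:R.
have rc0 : (\sum_(a <- E) (1 - r a i)) * c @[i --> tails le] --> (0 : R).
  rewrite -[X in _ --> X](mul0r c); apply: cvgMl.
  have : \sum_(a <- E) (1 - r a i) @[i --> tails le] -->
      \sum_(a <- E) (1 - 1 : R).
    apply: (cvg_big (@add_continuous R)) => a _.
    by apply: cvgB; [exact: cvg_cst|exact: r1].
  by rewrite subrr big1.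
have small : \forall i \near tails le, (\sum_(a <- E) (1 - r a i)) * c < e / 4.
  exact: (cvgr_lt (0 : R)).
near=> i.
have infi : inf S <= h (F i) / #|` F i|%:R.
  by apply: ge_inf; [case: S_inf|exists (F i) => //=; exact: F0].
have n0 : (0 : R) < #|` F i|%:R by rewrite ltr0n cardfs_gt0 F0.
rewrite distrC ger0_norm ?subr_ge0//.
suff : h (F i) / #|` F i|%:R <=
    h E / #|` E|%:R + e / 4 + (\sum_(a <- E) (1 - r a i)) * c.
  have : (\sum_(a <- E) (1 - r a i)) * c < e / 4 by near: i.
  lra.
have sum_defect : \sum_(a <- E) (#|` F i|%:R -
      (matching_number (F i) (ltranslate a (F i)) (U `&` V))%:R)
      * h [fset 1%g]%fset
    = #|` E|%:R * #|` F i|%:R * ((\sum_(a <- E) (1 - r a i)) * c).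
  rewrite mulr_suml mulr_sumr; apply: eq_bigr => a _.
  by rewrite /c /r; field; rewrite !gt_eqF.
have UVsep a b u v : a \in E -> b \in E -> (U `&` V) u -> (U `&` V) v ->
    (u^-1 * v = a * b^-1)%g -> a = b.
  by move=> aE bE [_ Vu] [_ Vv]; exact: Vsep.
have := rank_mean_bound (F i) UVsep (ltW e4) (fun u UVu => Usmall u UVu.1).
rewrite sum_defect natrM => bound.
rewrite -(ler_pM2l (mulr_gt0 m0 n0)); move: bound; congr (_ <= _).
  by field; rewrite gt_eqF.
by field; rewrite gt_eqF.
Unshelve. all: by end_near. Qed.

End thin_Folner_limit.

(** * Entropy of finite-valued random variables *)

Section finite_valued.
Context (R : realType) (d : measure_display) (X : measurableType d).
Context (mu : probability X R).

Definition fiber_measurable (V : Type) (Y : X -> V) :=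
  forall v, measurable (Y @^-1` [set v]).

Definition law (V : Type) (Y : X -> V) (v : V) : R :=
  fine (mu (Y @^-1` [set v])).

Lemma law_ge0 (V : Type) (Y : X -> V) v : 0 <= law Y v.
Proof. by rewrite fine_ge0// measure_ge0. Qed.

Lemma preimage_finite_bigcup (V : finType) (Y : X -> V) (P : set V) :
  Y @^-1` P = \bigcup_(v in P) Y @^-1` [set v].
Proof.
by apply/seteqP; split=> [x Px|x [v Pv /= ->]//]; exists (Y x).
Qed.

Lemma law_comp (V U : finType) (Y : X -> V) (k : V -> U) :
  fiber_measurable Y -> law (k \o Y) = marginal (law Y) k.
Proof.
move=> mY; apply/funext => u; rewrite /law comp_preimage preimage_finite_bigcup.
rewrite measure_fin_bigcup//; [|exact: finite_finset|]; last first.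
  by move=> v w _ _ [x [/= <- <-]].
have -> : k @^-1` [set u] = [set` [pred v | k v == u]].
  by apply/seteqP; split=> v /= /eqP.
rewrite -(@bigfs _ _ _ _ (index_enum V)) ?index_enum_uniq//; last first.
  by move=> v _; rewrite mem_index_enum.
by rewrite -sum_fine// => v _; exact: fin_num_measure.
Qed.

Definition entropy (V : finType) (Y : X -> V) : R := fin_entropy (law Y).

Lemma entropy_comp_inj (V U : finType) (Y : X -> V) (k : V -> U) :
  fiber_measurable Y -> injective k -> entropy (k \o Y) = entropy Y.
Proof. by move=> mY k_inj; rewrite /entropy law_comp// fin_entropy_inj. Qed.

Lemma entropy_comp_le (V U : finType) (Y : X -> V) (k : V -> U) :
  fiber_measurable Y -> entropy (k \o Y) <= entropy Y.
Proof.
move=> mY; rewrite /entropy law_comp// le_fin_entropy_marginal//.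
exact: law_ge0.
Qed.

Lemma fiber_measurable_pair (V W : finType) (Y : X -> V) (Z : X -> W) :
  fiber_measurable Y -> fiber_measurable Z ->
  fiber_measurable (fun x => (Y x, Z x)).
Proof.
move=> mY mZ [v w].
have -> : (fun x => (Y x, Z x)) @^-1` [set (v, w)] =
    Y @^-1` [set v] `&` Z @^-1` [set w].
  by apply/seteqP; split=> x /= [-> ->].
exact: measurableI.
Qed.

(** Conditioning on the coarser [k \o Z] leaves at least as much entropy in [Y]:
    [fin_entropy_submod] for the joint law. *)
Lemma entropy_submod (S V U : finType) (Y : X -> S) (Z : X -> V) (k : V -> U) :
  fiber_measurable Y -> fiber_measurable Z ->
  entropy (fun x => (Y x, Z x)) - entropy Z <=
  entropy (fun x => (Y x, k (Z x))) - entropy (k \o Z).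
Proof.
move=> mY mZ; have mYZ := fiber_measurable_pair mY mZ.
pose YZ x := (Y x, Z x).
have := fin_entropy_submod k (law_ge0 YZ).
rewrite -!law_comp// -/(entropy YZ).
rewrite -[fin_entropy _ in leLHS]/(entropy (k \o Z)).
rewrite -[fin_entropy _ in X in _ <= X + _]/(entropy (fun x => (Y x, k (Z x)))).
rewrite -[fin_entropy _ in leRHS]/(entropy Z).
lra.
Qed.

(** P ∩ Z is contained in the union of Q ∩ Z and the symmetric difference of P and Q, and
    symmetrically. *)
Lemma measure_setI_dist (P Q Z : set X) :
  measurable P -> measurable Q -> measurable Z ->
  `|fine (mu (P `&` Z)) - fine (mu (Q `&` Z))| <= fine (mu (P `+` Q)).
Proof.
move=> mP mQ mZ.
have mPQ : measurable (P `+` Q) by apply: measurableU; exact: measurableD.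
have le1 (B C : set X) : measurable B -> measurable C -> measurable (B `+` C) ->
    fine (mu (B `&` Z)) <= fine (mu (C `&` Z)) + fine (mu (B `+` C)).
  move=> mB mC mBC; rewrite -fineD ?fin_num_measure//; try exact: measurableI.
  apply: fine_le; rewrite ?fin_numD ?fin_num_measure//; try exact: measurableI.
  have mCZ := measurableI _ _ mC mZ.
  apply: le_trans (measureU2 mu mCZ mBC); apply: le_measure; rewrite ?inE.
  - exact: measurableI.
  - exact: measurableU.
  - move=> x [Bx Zx]; have [Cx|Cx] := pselect (C x); first by left.
    by right; left.
rewrite ler_norml; have := le1 _ _ mP mQ mPQ.
have := le1 _ _ mQ mP; rewrite (setYC Q P) => /(_ mPQ).
lra.
Qed.

End finite_valued.

(** * Itineraries under the action and their entropy *)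

Section dynamics.
Context (R : realType) (G : topologicalGroupType).
Context (d : measure_display) (X : measurableType d) (mu : probability X R).
Context (pi : G -> X -> X).
Hypothesis hpi : measure_preserving_action mu pi.

Lemma action_preimage g (A : set X) : pi g @^-1` A = pi g^-1%g @` A.
Proof.
have [pi1 piM] := mpa_action hpi.
apply/seteqP; split=> [x Ax|_ [x Ax <-]].
  by exists (pi g x) => //; rewrite -piM mulVg pi1.
by rewrite /preimage/= -piM mulgV pi1.
Qed.

Lemma measurable_action_preimage g (A : set X) :
  measurable A -> measurable (pi g @^-1` A).
Proof. by move=> mA; rewrite -[_ @^-1` _]setTI; exact: (mpa_measurable hpi). Qed.

Lemma entropy_comp_action (V : finType) (Y : X -> V) g :
  fiber_measurable Y -> entropy mu (Y \o pi g) = entropy mu Y.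
Proof.
move=> mY; apply: eq_bigr => v _; congr nxlnx; rewrite /law comp_preimage.
by rewrite action_preimage (mpa_preserving hpi).
Qed.

Context (T : finType) (a : X -> T).
Hypothesis ma : fiber_measurable a.

(** The word naming the cell of the refined partition that contains [x]; it takes values in a finite
    type. *)
Definition itinerary (F : {fset G}) (x : X) : {ffun F -> T} :=
  [ffun g : F => a (pi (val g) x)].

Lemma fiber_measurable_action g : fiber_measurable (a \o pi g).
Proof. by move=> t; rewrite comp_preimage; exact: measurable_action_preimage. Qed.

Lemma itinerary_preimage (F : {fset G}) (w : {ffun F -> T}) :
  itinerary F @^-1` [set w] = \bigcap_g pi (val g) @^-1` (a @^-1` [set w g]).
Proof.
apply/seteqP; split => [x /= <- g _ /=|x hx]; first by rewrite ffunE.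
by apply/ffunP => g; rewrite ffunE; exact: hx.
Qed.

Lemma fiber_measurable_itinerary F : fiber_measurable (itinerary F).
Proof.
move=> w; rewrite itinerary_preimage; apply: fin_bigcap_measurable => [|g _].
  exact: finite_finset.
exact: measurable_action_preimage.
Qed.

Let h (F : {fset G}) := entropy mu (itinerary F).

Definition word_restrict (A B : {fset G}) (AB : (A `<=` B)%fset)
  (w : {ffun B -> T}) : {ffun A -> T} := [ffun g : A => w (fincl AB g)].

Lemma itinerary_restrict (A B : {fset G}) (AB : (A `<=` B)%fset) :
  itinerary A = word_restrict AB \o itinerary B.
Proof. by apply/funext => x; apply/ffunP => g; rewrite !ffunE. Qed.

Lemma entropy_itineraryU1 g (F : {fset G}) :
  h (g |` F)%fset = entropy mu (fun x => (a (pi g x), itinerary F x)).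
Proof.
pose k (w : {ffun (g |` F)%fset -> T}) :=
  (w [` fset1U1 g F]%fset, word_restrict (fsubsetUr _ _) w).
have k_inj : injective k.
  move=> w w' [wg /ffunP wF]; apply/ffunP => -[x xgF].
  have := xgF; rewrite !inE => /orP[/eqP xg|xF].
    by subst x; rewrite (bool_irrelevance xgF (fset1U1 g F)).
  have -> : [` xgF]%fset = fincl (fsubsetUr [fset g]%fset F) [` xF]%fset.
    exact: val_inj.
  by have := wF [` xF]%fset; rewrite !ffunE.
rewrite /h -(entropy_comp_inj mu (@fiber_measurable_itinerary _) k_inj).
congr entropy; apply/funext => x /=; congr pair; first by rewrite ffunE.
by rewrite [in RHS](itinerary_restrict (fsubsetUr [fset g]%fset F)).
Qed.

Lemma itinerary_submodular_rank : submodular_rank h.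
Proof.
split=> [|A B AB|g A B AB].
- pose k (w : {ffun (fset0 : {fset G}) -> T}) := tt.
  have k_inj : injective k by move=> w w' _; apply/ffunP => -[].
  rewrite /h -(entropy_comp_inj mu (@fiber_measurable_itinerary _) k_inj).
  rewrite /entropy /fin_entropy (big_pred1 tt) => [|[]//].
  rewrite /law (_ : _ @^-1` _ = setT).
    by rewrite probability_setT /nxlnx ln1 mulr0 oppr0.
  by apply/seteqP; split.
- rewrite /h (itinerary_restrict AB); apply: entropy_comp_le.
  exact: fiber_measurable_itinerary.
- rewrite !entropy_itineraryU1 /h (itinerary_restrict AB).
  apply: (entropy_submod mu _ (@fiber_measurable_action g)).
  exact: fiber_measurable_itinerary.
Qed.

(** The letter of [x] at y g is the letter of [pi g x] at y, and [pi g] preserves the measure. *)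
Lemma entropy_itinerary_mulr g (A : {fset G}) :
  h [fset (x * g)%g | x in A]%fset = h A.
Proof.
set Ag := [fset _ | _ in A]%fset.
have mulA (x : A) : (val x * g)%g \in Ag.
  by apply/imfsetP; exists (val x) => //=; exact: valP.
pose k (w : {ffun Ag -> T}) : {ffun A -> T} :=
  [ffun x : A => w [` mulA x]%fset].
have k_inj : injective k.
  move=> w w' /ffunP kw; apply/ffunP => -[y yAg].
  have [x /= xA yx] := imfsetP _ _ _ _ yAg; subst y.
  have -> : [` yAg]%fset = [` mulA [` xA]%fset]%fset by exact: val_inj.
  by have := kw [` xA]%fset; rewrite !ffunE.
rewrite /h -[RHS](entropy_comp_action g (@fiber_measurable_itinerary _)).
rewrite -(entropy_comp_inj mu (@fiber_measurable_itinerary _) k_inj).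
congr entropy; apply/funext => x; apply/ffunP => y; rewrite !ffunE/=.
by rewrite (mpa_action hpi).2.
Qed.

(** Continuity of the action at 1 concerns images; preimages are reached by composing with
    inversion. *)
Lemma action_setY_cvg (A : set X) : measurable A ->
  fine (mu (pi g @^-1` A `+` A)) @[g --> (1%g : G)] --> (0 : R).
Proof.
move=> mA; have [pi1 _] := mpa_action hpi.
have pi1A : pi 1%g @` A = A.
  rewrite -[1%g]invg1 -action_preimage.
  by apply/seteqP; split=> x; rewrite /preimage/= pi1.
have c : mu (A `+` pi g @` A) @[g --> (1%g : G)] --> (0%E : \bar R).
  rewrite -[X in _ --> X](_ : mu (A `+` pi 1%g @` A) = _); last first.
    by rewrite pi1A setYK measure0.
  exact: (mpa_continuous hpi mA).
have ci : mu (A `+` pi g^-1%g @` A) @[g --> (1%g : G)] --> (0%E : \bar R).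
  have inv1 : (g : G)^-1%g @[g --> (1%g : G)] --> (1%g : G).
    by rewrite -[X in _ --> X](@invg1 G); exact: invg_continuous.
  exact: (cvg_comp _ _ inv1 c).
apply: fine_cvg; rewrite /=.
by under eq_fun do rewrite action_preimage setYC.
Qed.

(** As g tends to 1, the law of the pair tends pointwise to that of the diagonal pair (a, a), whose
    entropy is that of [a]. *)
Lemma entropy_pair_cvg :
  entropy mu (fun x => (a (pi g x), a x)) @[g --> (1%g : G)] --> entropy mu a.
Proof.
have [pi1 _] := mpa_action hpi.
have diag_inj : injective (fun t : T => (t, t)) by move=> s t [].
rewrite -(entropy_comp_inj mu ma diag_inj).
apply: (@cvg_big R _ _ _ _ (@add_continuous R)) => -[s t] _.
apply: continuous_cvg; first by apply: continuous_nxlnx; exact: law_ge0.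
have lawE g : law mu (fun x => (a (pi g x), a x)) (s, t) =
    fine (mu (pi g @^-1` (a @^-1` [set s]) `&` a @^-1` [set t])).
  by congr (fine (mu _)); apply/seteqP; split=> x /= [-> ->].
have -> : law mu ((fun t => (t, t)) \o a) (s, t) =
    fine (mu (a @^-1` [set s] `&` a @^-1` [set t])).
  by congr (fine (mu _)); apply/seteqP; split=> x /= [-> ->].
under eq_fun do rewrite lawE.
apply/cvgrPdist_le => /= e e0.
have /cvgrPdist_le/(_ _ e0) := action_setY_cvg (ma s).
apply: filterS => g; rewrite sub0r normrN distrC => le_e.
apply: le_trans le_e; rewrite (le_trans _ (ler_norm _))// measure_setI_dist//.
exact: measurable_action_preimage.
Qed.

(** The difference is the conditional entropy of [a \o pi u] given [a], which tends to 0 by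
    [entropy_pair_cvg]. *)
Lemma entropy_itinerary_small (e : R) : 0 < e ->
  exists2 U : set G, nbhs (1%g : G) U &
    forall u, U u -> h [fset u; 1%g]%fset - h [fset 1%g]%fset <= e.
Proof.
move=> e0; have [pi1 _] := mpa_action hpi.
pose k (w : {ffun [fset 1%g : G]%fset -> T}) := w [` fset11 1%g]%fset.
have k_inj : injective k.
  move=> w w' ww'; apply/ffunP => -[x x1]; have := x1; rewrite inE => /eqP x1'.
  by subst x; rewrite (bool_irrelevance x1 (fset11 1%g)).
have kE : k \o itinerary [fset 1%g]%fset = a.
  by apply/funext => x; rewrite /k /= ffunE /= pi1.
have h1 : h [fset 1%g]%fset = entropy mu a.
  by rewrite -kE entropy_comp_inj//; exact: fiber_measurable_itinerary.
have h2 u : h [fset u; 1%g]%fset = entropy mu (fun x => (a (pi u x), a x)).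
  rewrite entropy_itineraryU1.
  have k2_inj : injective (fun z : T * _ => (z.1, k z.2)).
    by move=> [s w] [s' w'] /= [-> /k_inj ->].
  have -> : (fun x => (a (pi u x), a x)) = (fun z => (z.1, k z.2)) \o
      (fun x => (a (pi u x), itinerary [fset 1%g]%fset x)).
    by apply/funext => x /=; congr pair; rewrite -{1}kE.
  rewrite entropy_comp_inj//.
  exact: (fiber_measurable_pair (@fiber_measurable_action u)
                                (@fiber_measurable_itinerary _)).
exists [set u | h [fset u; 1%g]%fset - h [fset 1%g]%fset <= e] => //.
have /cvgrPdist_le/(_ _ e0) := entropy_pair_cvg.
apply: filterS => u /=; rewrite h1 h2 distrC; apply: le_trans; exact: ler_norm.
Qed.

End dynamics.

(** * From measurable partitions to itineraries *)

Section partitions.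
Context (R : realType) (G : topologicalGroupType).
Context (d : measure_display) (X : measurableType d) (mu : probability X R).
Context (pi : G -> X -> X).

Lemma partition_itinerary (alpha : set (set X)) :
  finite_measurable_partition alpha ->
  exists (S : {fset set X}) (a : X -> S),
    alpha = [set` S] /\ forall t : S, a @^-1` [set t] = val t.
Proof.
move=> [/finite_fsetP[S ->] _ disj cover]; exists S.
have /choice[a ha] x : exists t : S, val t x.
  have : [set: X] x by [].
  by rewrite -cover => -[A /= AS Ax]; exists [` AS]%fset.
exists a; split=> // t; apply/seteqP; split=> x /= => [<-|tx]; first exact: ha.
apply: val_inj; apply: disj; [exact: valP|exact: valP|].
by exists x.
Qed.

Context (hpi : measure_preserving_action mu pi).
Context (S : {fset set X}) (a : X -> S).
Hypothesis aE : forall t : S, a @^-1` [set t] = val t.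
Hypothesis ma : fiber_measurable a.

(** Different words may share the empty cell; restricting to positive measure makes the passage from
    words to cells injective. *)
Lemma refine_partition_cells (F : {fset G}) :
  set_bij [set w | (0 < mu (itinerary pi a F @^-1` [set w]))%E]
    [set A | refine_partition pi [set` S] F A /\ (0 < mu A)%E]
    (fun w => itinerary pi a F @^-1` [set w]).
Proof.
have cellE (w : {ffun F -> S}) (A : G -> set X) :
    (forall g : F, A (val g) = val (w g)) ->
    itinerary pi a F @^-1` [set w] = \bigcap_(g in [set` F]) (pi (g^-1)%g @` A g).
  move=> Aw; rewrite itinerary_preimage; apply/seteqP; split=> x hx g.
    move=> gF; suff : (pi g @^-1` A g) x by rewrite (action_preimage hpi).
    by rewrite -[g]/(val [` gF]%fset) Aw -aE; exact: hx.
  move=> _; rewrite aE -Aw; suff : (pi (val g)^-1%g @` A (val g)) x.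
    by rewrite -(action_preimage hpi).
  by apply: hx; exact: valP.
split=> [w /= w0|w w'|A [[B hB <-] A0]].
(* The word is extended to all of [G] by the empty set outside [F]. *)
- split=> //; exists (fun g => oapp (fun t : F => val (w t)) set0 (insub g)).
    by move=> g gF; rewrite insubT/=; exact: valP.
  by apply/esym/cellE => g; rewrite valK.
- rewrite !inE => w0 _ ww'.
  have /set0P[x xw] : itinerary pi a F @^-1` [set w] != set0.
    by apply: contraTneq w0 => ->; rewrite measure0 ltxx.
  by have := xw; rewrite {1}ww' /= => <-; exact/esym.
- pose w : {ffun F -> S} := [ffun g : F => [` hB (val g) (valP g)]%fset].
  have /cellE wB : forall g : F, B (val g) = val (w g) by move=> g; rewrite ffunE.
  by exists w => //=; rewrite wB.
Qed.

(** Words with null cells contribute [nxlnx 0 = 0], so the sum over positive cells extends to all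
    words. *)
Lemma shannon_entropy_itinerary (F : {fset G}) :
  shannon_entropy mu (refine_partition pi [set` S] F) =
  entropy mu (itinerary pi a F).
Proof.
rewrite /shannon_entropy (reindex_fsbig _ _ _ _ (refine_partition_cells F)).
rewrite -[X in \sum_(i \in X) _]
  /[set` [pred w | (0 < mu (itinerary pi a F @^-1` [set w]))%E]].
rewrite -(@bigfs _ _ _ _ (index_enum _)) ?index_enum_uniq//; last first.
  by move=> w _; rewrite mem_index_enum.
rewrite -sumrN big_mkcond; apply: eq_bigr => w _ /=; case: ifPn => //.
by rewrite -leNgt measure_le0 /law => /eqP ->; rewrite nxlnx0.
Qed.

End partitions.

(** * Equality of the two entropies *)

(** As [lim] is a total function, the convergence in the first conjunct certifies that
    [Ollagnier_entropy] is built from genuine limits. *)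
Theorem theorem6p14 (R : realType) (G : topologicalGroupType)
    (hG : hausdorff_space G) (amG : amenable R G)
    (d : measure_display) (X : measurableType d) (mu : probability X R)
    (pi : G -> X -> X) (hpi : measure_preserving_action mu pi)
    (I : Type) (le : I -> I -> Prop) (F : I -> {fset G})
    (hF : thin_Folner_net R le F) :
  (forall alpha : set (set X), finite_measurable_partition alpha ->
     cvg (mean_entropy mu pi alpha (F i) @[i --> tails le])) /\
  Ollagnier_entropy mu pi le F = naive_entropy mu pi.
Proof.
pose S alpha :=
  [set mean_entropy mu pi alpha E | E in [set E : {fset G} | E != fset0]].
have key alpha : finite_measurable_partition alpha ->
    (mean_entropy mu pi alpha (F i) @[i --> tails le] --> inf (S alpha)) /\
    lbound (S alpha) 0.
  move=> ha; have [T [a [alphaT aT]]] := partition_itinerary ha.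
  have ma : fiber_measurable a.
    move=> t; rewrite aT; apply: (fmp_measurable ha).
    by rewrite alphaT; exact: valP.
  have meanE E : mean_entropy mu pi alpha E =
      entropy mu (itinerary pi a E) / #|` E|%:R.
    by rewrite /mean_entropy alphaT (shannon_entropy_itinerary hpi aT).
  have rk := itinerary_submodular_rank hpi ma.
  rewrite /S; under eq_fun do rewrite meanE.
  under eq_imagel do rewrite meanE.
  split.
    apply: thin_Folner_rank_cvg => //.
    - by move=> g A; exact: entropy_itinerary_mulr.
    - by move=> e; exact: entropy_itinerary_small.
  exact: rank_mean_lbound.
have PF : ProperFilter (tails le) by case: hF => /tails_proper.
split=> [alpha /key[/cvgP]//|].
rewrite /Ollagnier_entropy /naive_entropy; congr ereal_sup.
apply: eq_imagel => alpha /key[/cvg_lim -> // lb].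
(* [S alpha] is nonempty and bounded below, so its real and extended infima agree. *)
rewrite -(ereal_inf_EFin (A := S alpha)).
- by rewrite /S image_comp.
- by exists 0.
- exists (mean_entropy mu pi alpha [fset 1%g]%fset), [fset 1%g]%fset => //=.
  by rewrite -cardfs_eq0 cardfs1.
Qed.
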